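(* For every power of two $n\ge 2$, there is an explicit zero-diagonal Hermitian unitary $A_n\in M_n(\mathbb{C})$ (namely the matrix $A_n$ defined in the context) such that: (i) For every dyadic $r\le n$ (that is, $r=2^\ell$ with an integer $\ell\ge 0$ and $r\le n$), $$p_r(A_n)=\sqrt{\frac{n/r-1}{n-1}}.$$ In particular, for every $0<\varepsilon<1$, the entire family admits $\varepsilon$-pavings with fewer than $2\varepsilon^{-2}$ blocks (that is, for every power of two $n\ge2$ the matrix $A_n$ has an $\varepsilon$-paving with fewer than $2\varepsilon^{-2}$ blocks). (ii) Among the representations $A_n=BC-CB$ with $B,C\in M_n(\mathbb{C})$ both normal (and with no requirement that either be diagonal in the standard basis), the least value of $\lVert B\rVert\,\lVert C\rVert$ is exactly $1/2$. (iii) If $n=4^k$ with $k\ge 1$, then $$\lambda(A_n)\ge\sqrt{\frac{(3k-1)n+1}{32(n-1)}}\ge\frac{\sqrt{k}}{4}.$$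
   Context: $\lVert\cdot\rVert$ is the operator norm on Euclidean space. All diagonal matrices, principal submatrices and coordinate partitions refer to the standard basis. The family: let $S_1=(0)$ and, for $n$ a power of two, $$S_{2n}=\begin{pmatrix}S_n&S_n+I_n\\ S_n-I_n&-S_n\end{pmatrix}.$$ For every power of two $n\ge2$ put $A_n=\dfrac{\mathrm{i}\,S_n}{\sqrt{n-1}}$. Diagonal commutator cost: let $Q=[-1,1]+\mathrm{i}[-1,1]\subset\mathbb{C}$. For a zero-diagonal $A\in M_m(\mathbb{C})$, $$\lambda(A)=\min\{\lVert C\rVert:\ A=BC-CB,\ B,C\in M_m(\mathbb{C}),\ B\text{ diagonal with entries in }Q\}.$$ Paving: for $A\in M_m(\mathbb{C})$ and a coordinate set $S\subseteq\{1,\dots,m\}$, let $A_S$ be the principal submatrix of $A$ indexed by $S$. For $1\le r\le m$, $$p_r(A)=\min_{\mathcal P}\ \max_{S\in\mathcal P}\lVert A_S\rVert,$$ the minimum being over partitions $\mathcal P$ of $\{1,\dots,m\}$ with $|\mathcal P|\le r$. An $\varepsilon$-paving of $A$ is a partition $\mathcal P$ of $\{1,\dots,m\}$ such that $\max_{S\in\mathcal P}\lVert A_S\rVert\le\varepsilon\lVert A\rVert$; its blocks are the elements of $\mathcal P$. *)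

(* Defs.v *)
From HB Require Import structures.
From mathcomp Require Import all_boot all_order all_algebra.
From mathcomp Require Import sesquilinear spectral complex.
From mathcomp Require Import boolp classical_sets reals.
Set Implicit Arguments.
Unset Strict Implicit.
Unset Printing Implicit Defensive.
Import Order.TTheory GRing.Theory Num.Theory.
Local Open Scope classical_set_scope.
Local Open Scope ring_scope.
Local Open Scope complex_scope.

Section Minimum.
Variable R : realType.
Implicit Types (E : set R) (x : R).

Definition is_minimum E x : Prop := E x /\ lbound E x.

(* The default value 0 is returned when E has no least element. *)
Definition minimum E : R := xget 0 [set x | is_minimum E x].
End Minimum.

Section Norms.
Variables (R : realType) (n : nat).

Definition vnorm (x : 'cV[R[i]]_n) : R :=
  Num.sqrt (\sum_(i < n) Normc.normc (x i 0) ^+ 2).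

Definition opnorm (A : 'M[R[i]]_n) : R :=
  sup [set vnorm (A *m x) | x in [set x : 'cV[R[i]]_n | vnorm x <= 1]].
End Norms.

Section Family.
Variable R : realType.

Fact double_pow2 (k : nat) : (2 ^ k + 2 ^ k = 2 ^ k.+1)%N.
Proof. by rewrite expnS mul2n addnn. Qed.

(* Smx k and Amx k are S_n and A_n for n = 2 ^ k; Amx 0 is a junk value. *)
Fixpoint Smx (k : nat) : 'M[R[i]]_(2 ^ k) :=
  if k is k'.+1 then
    castmx (double_pow2 k', double_pow2 k')
      (block_mx (Smx k') (Smx k' + 1%:M) (Smx k' - 1%:M) (- Smx k'))
  else 0.

Definition Amx (k : nat) : 'M[R[i]]_(2 ^ k) :=
  ('i / (Num.sqrt ((2 ^ k)%:R - 1 : R))%:C) *: Smx k.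
End Family.

Section Costs.
Variables (R : realType) (m : nat).
Implicit Types (A B C : 'M[R[i]]_m) (P : {set {set 'I_m}}).

Definition commutator B C : 'M[R[i]]_m := B *m C - C *m B.

Definition in_square (z : R[i]) : Prop :=
  `|complex.Re z| <= 1 /\ `|complex.Im z| <= 1.

Definition lambda A : R :=
  minimum [set opnorm C | C in [set C | exists B,
    [/\ is_diag_mx B, forall i, in_square (B i i) & A = commutator B C]]].

Definition principal_submx A (S : {set 'I_m}) : 'M[R[i]]_#|S| :=
  mxsub (@enum_val _ (mem S)) (@enum_val _ (mem S)) A.

(* opnorm is nonnegative, so 0 is a neutral starting value for the maximum. *)
Definition paving_norm A P : R :=
  \big[Num.max/0]_(S in P) opnorm (principal_submx A S).

Definition paving_number (r : nat) A : R :=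
  minimum [set paving_norm A P |
    P in [set P | finset.partition P (finset.setTfor 'I_m) /\ (#|P| <= r)%N]].

Definition is_paving (eps : R) A P : Prop :=
  finset.partition P (finset.setTfor 'I_m) /\ paving_norm A P <= eps * opnorm A.

Definition normal_commutator_costs A : set R :=
  [set x | exists B C, [/\ B \is normalmx, C \is normalmx,
    A = commutator B C & x = opnorm B * opnorm C]].
End Costs.

(* Main.v *)
Require Import Defs.
From HB Require Import structures.
From mathcomp Require Import all_boot all_order all_algebra.
From mathcomp Require Import sesquilinear spectral complex.
From mathcomp Require Import boolp classical_sets reals.
From mathcomp Require Import topology normedtype derive realfun.
From mathcomp Require Import ring lra.
Set Implicit Arguments.
Unset Strict Implicit.
Unset Printing Implicit Defensive.
Import Order.TTheory GRing.Theory Num.Theory.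
Import numFieldNormedType.Exports.
Import Normc.
Local Open Scope ring_scope.
Local Open Scope complex_scope.

(** The doubling recursion keeps [S_n] real and skew-symmetric and gives
    [S_n ^ 2 = - (n - 1) I] ([Smx_tr], [Smx_sqr]); hence [A_n = i S_n / sqrt (n - 1)]
    is a zero-diagonal Hermitian unitary, all of whose off-diagonal entries have
    modulus [1 / sqrt (n - 1)].

    Paving. The diagonal blocks of [S_n] on the dyadic intervals of length
    [m = n / r] are [S_m] or [- S_m], so after rescaling the block-diagonal part of
    [A_n] is [sqrt ((m - 1) / (n - 1))] times a unitary ([dyadic_part_sqr]). This
    paves [A_n] with [r] blocks. Conversely, among at most [r] blocks one has at
    least [m] elements, and a single column of the corresponding submatrix already
    has length at least [sqrt ((m - 1) / (n - 1))] ([principal_Amx_ge]).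

    Normal factors. From [1 = ||A|| <= 2 ||B|| ||C||] no product of norms is below
    [1/2]. A self-adjoint unitary [B] with [B A = - A B] attains it, with
    [C = B A / 2], which is skew-adjoint. Such a [B] comes from the [2 x 2] block
    structure ([exists_anticommuting_reflection]).

    Diagonal factor. If [B = diag (b_i)] then [A i j = (b_i - b_j) C i j], so
    [n ||C||^2] is at least the squared Frobenius norm of [C], which is
    [1 / (n - 1)] times the sum of [|b_i - b_j|^-2] over [i != j]. For [n = 4 ^ j]
    points in a square of side 2 this energy is at least [3 j n^2 / 32]
    ([inverse_square_energy]): at each of the [j] dyadic scales, points sharing a
    cell are close, and by Cauchy-Schwarz many pairs share a cell. This is slightly
    more than the stated bound. Since the cost is defined as the least element of a
    set of norms, the bound also needs that this set has a least element; that is a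
    compactness argument ([exists_minimal_diagonal_commutator]). *)

(** * Euclidean and operator norms *)

Section Minimum.
Variable R : realType.

Lemma minimumE (E : set R) x : is_minimum E x -> minimum E = x.
Proof.
move=> Ex; rewrite /minimum; case: xgetP => [y _ [Ey ly]|/(_ x)/(_ Ex)[]].
by case: Ex => Ex lx; apply/eqP; rewrite eq_le ly//= lx.
Qed.
End Minimum.

Section Norms.
Local Open Scope sesquilinear_scope.
Variable R : realType.
Local Notation C := R[i].

Lemma normc_ge0 (z : C) : 0 <= normc z.
Proof. by case: z => a b; rewrite sqrtr_ge0. Qed.

Lemma sqr_normcE (z : C) : normc z ^+ 2 = complex.Re z ^+ 2 + complex.Im z ^+ 2.
Proof. by case: z => a b; rewrite sqr_sqrtr// addr_ge0 ?sqr_ge0. Qed.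

Lemma normc_real (a : R) : normc a%:C = `|a|.
Proof. by rewrite /normc /= expr0n /= addr0 sqrtr_sqr. Qed.

Lemma normc_sum (I : finType) (f : I -> C) :
  normc (\sum_i f i) <= \sum_i normc (f i).
Proof.
elim/big_ind2: _ => [|x1 x2 y1 y2 h1 h2|//]; first by rewrite normc0.
by rewrite (le_trans (le_normcD _ _))// lerD.
Qed.

(** Cauchy-Schwarz, from Lagrange's identity. *)
Lemma sqr_sum_le (I : finType) (a b : I -> R) :
  (\sum_i a i * b i) ^+ 2 <= (\sum_i a i ^+ 2) * (\sum_i b i ^+ 2).
Proof.
have E (u v : I -> R) : (\sum_i u i) * (\sum_j v j) = \sum_i \sum_j u i * v j.
  by rewrite big_distrl /=; apply: eq_bigr => i _; rewrite big_distrr.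
have : 0 <= \sum_i \sum_j (a i * b j - a j * b i) ^+ 2.
  by apply: sumr_ge0 => i _; apply: sumr_ge0 => j _; rewrite sqr_ge0.
have -> : \sum_i \sum_j (a i * b j - a j * b i) ^+ 2 =
  \sum_i \sum_j a i ^+ 2 * b j ^+ 2 + \sum_i \sum_j b i ^+ 2 * a j ^+ 2
  - 2 * \sum_i \sum_j (a i * b i) * (a j * b j).
  rewrite mulr_sumr -big_split -sumrB /=; apply: eq_bigr => i _.
  rewrite mulr_sumr -big_split -sumrB /=; apply: eq_bigr => j _; ring.
rewrite -!E -expr2; lra.
Qed.

Lemma vnorm_ge0 n (x : 'cV[C]_n) : 0 <= vnorm x.
Proof. exact: sqrtr_ge0. Qed.

Lemma sqr_vnorm n (x : 'cV[C]_n) : vnorm x ^+ 2 = \sum_i normc (x i 0) ^+ 2.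
Proof. by rewrite sqr_sqrtr// sumr_ge0// => i _; rewrite sqr_ge0. Qed.

Lemma vnorm_sqr_le n m (x : 'cV[C]_n) (y : 'cV[C]_m) :
  \sum_i normc (x i 0) ^+ 2 <= \sum_i normc (y i 0) ^+ 2 -> vnorm x <= vnorm y.
Proof. by rewrite -!sqr_vnorm ler_sqr ?nnegrE ?vnorm_ge0. Qed.

Lemma vnorm0 n : vnorm (0 : 'cV[C]_n) = 0.
Proof. by rewrite /vnorm big1 ?sqrtr0// => i _; rewrite mxE normc0 expr0n. Qed.

Lemma vnorm_eq0 n (x : 'cV[C]_n) : vnorm x = 0 -> x = 0.
Proof.
move=> x0; have /eqP := sqr_vnorm x; rewrite x0 expr0n eq_sym /=.
rewrite psumr_eq0 => [/allP h|i _]; last by rewrite sqr_ge0.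
apply/matrixP => i j; rewrite ord1 mxE; apply: eq0_normc; apply/eqP.
by have := h i (mem_index_enum _); rewrite sqrf_eq0.
Qed.

Lemma vnormZ n (a : C) (x : 'cV[C]_n) : vnorm (a *: x) = normc a * vnorm x.
Proof.
apply/eqP; rewrite -(@eqrXn2 _ 2)// ?mulr_ge0 ?vnorm_ge0 ?normc_ge0//.
rewrite exprMn !sqr_vnorm mulr_sumr; apply/eqP/eq_bigr => i _.
by rewrite mxE normcM exprMn.
Qed.

Lemma vnormN n (x : 'cV[C]_n) : vnorm (- x) = vnorm x.
Proof. by rewrite -scaleN1r vnormZ normcN normc1 mul1r. Qed.

Lemma vnormD n (x y : 'cV[C]_n) : vnorm (x + y) <= vnorm x + vnorm y.
Proof.
rewrite -ler_sqr ?nnegrE ?addr_ge0 ?vnorm_ge0//.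
apply: (@le_trans _ _ (\sum_i (normc (x i 0) + normc (y i 0)) ^+ 2)).
  rewrite sqr_vnorm; apply: ler_sum => i _; rewrite mxE.
  by rewrite ler_sqr ?nnegrE ?addr_ge0 ?normc_ge0// le_normcD.
have -> : \sum_i (normc (x i 0) + normc (y i 0)) ^+ 2 =
    vnorm x ^+ 2 + vnorm y ^+ 2 + 2 * \sum_i normc (x i 0) * normc (y i 0).
  rewrite !sqr_vnorm mulr_sumr -!big_split /=; apply: eq_bigr => i _; ring.
have : \sum_i normc (x i 0) * normc (y i 0) <= vnorm x * vnorm y.
  rewrite -ler_sqr ?nnegrE ?mulr_ge0 ?vnorm_ge0//.
    by rewrite exprMn !sqr_vnorm sqr_sum_le.
  by apply: sumr_ge0 => i _; rewrite mulr_ge0 ?normc_ge0.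
by lra.
Qed.

(** Cauchy-Schwarz in each row: the Frobenius norm bounds the operator norm. *)
Lemma vnorm_mulmx_frobenius n (A : 'M[C]_n) (x : 'cV[C]_n) :
  vnorm (A *m x) <= Num.sqrt (\sum_i \sum_j normc (A i j) ^+ 2) * vnorm x.
Proof.
have F0 : 0 <= \sum_i \sum_j normc (A i j) ^+ 2.
  by apply: sumr_ge0 => i _; apply: sumr_ge0 => j _; rewrite sqr_ge0.
rewrite -ler_sqr ?nnegrE ?mulr_ge0 ?vnorm_ge0 ?sqrtr_ge0//.
rewrite exprMn !sqr_vnorm (sqr_sqrtr F0) mulr_suml; apply: ler_sum => i _.
rewrite mxE; apply: le_trans (sqr_sum_le _ _).
rewrite ler_sqr ?nnegrE ?normc_ge0//.
  by apply: le_trans (normc_sum _) _; apply: ler_sum => j _; rewrite normcM.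
by apply: sumr_ge0 => j _; rewrite mulr_ge0 ?normc_ge0.
Qed.

Section Opnorm.
Variable n : nat.
Implicit Types (A B : 'M[C]_n) (x : 'cV[C]_n).

Lemma opnorm_le A c : 0 <= c -> (forall x, vnorm (A *m x) <= c * vnorm x) ->
  opnorm A <= c.
Proof.
move=> c0 h; apply: ge_sup.
  by exists (vnorm (A *m 0)), 0 => //=; rewrite vnorm0.
move=> _ [x /= x1 <-]; apply: le_trans (h x) _.
by rewrite -[leRHS]mulr1 ler_wpM2l.
Qed.

Lemma vnorm_mulmx_unit A x : vnorm x <= 1 -> vnorm (A *m x) <= opnorm A.
Proof.
move=> x1; apply: ub_le_sup; last by exists x.
exists (Num.sqrt (\sum_i \sum_j normc (A i j) ^+ 2)) => _ [y /= y1 <-].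
apply: le_trans (vnorm_mulmx_frobenius A y) _.
by rewrite -[leRHS]mulr1 ler_wpM2l// sqrtr_ge0.
Qed.

Lemma opnorm_ge0 A : 0 <= opnorm A.
Proof.
have := @vnorm_mulmx_unit A 0; rewrite mulmx0 vnorm0 => h.
by apply: h; rewrite ler01.
Qed.

Lemma vnorm_mulmx A x : vnorm (A *m x) <= opnorm A * vnorm x.
Proof.
have [x0|x0] := eqVneq (vnorm x) 0.
  by rewrite x0 mulr0 (vnorm_eq0 x0) mulmx0 vnorm0.
have xp : 0 < vnorm x by rewrite lt_def x0 vnorm_ge0.
have := @vnorm_mulmx_unit A ((vnorm x)^-1%:C *: x).
rewrite -scalemxAr !vnormZ normc_real ger0_norm ?invr_ge0 ?vnorm_ge0//.
by rewrite mulVf// lexx mulrC ler_pdivrMr//; apply.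
Qed.

Lemma opnorm_frobenius A :
  opnorm A <= Num.sqrt (\sum_i \sum_j normc (A i j) ^+ 2).
Proof. by apply: opnorm_le (vnorm_mulmx_frobenius A); rewrite sqrtr_ge0. Qed.

Lemma opnormD A B : opnorm (A + B) <= opnorm A + opnorm B.
Proof.
apply: opnorm_le => [|x]; first by rewrite addr_ge0 ?opnorm_ge0.
by rewrite mulmxDl mulrDl (le_trans (vnormD _ _))// lerD// vnorm_mulmx.
Qed.

Lemma opnormZ_le a A : opnorm (a *: A) <= normc a * opnorm A.
Proof.
apply: opnorm_le => [|x]; first by rewrite mulr_ge0 ?opnorm_ge0 ?normc_ge0.
by rewrite -scalemxAl vnormZ -mulrA ler_wpM2l ?normc_ge0 ?vnorm_mulmx.
Qed.

Lemma opnormN_le A : opnorm (- A) <= opnorm A.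
Proof. by rewrite -scaleN1r (le_trans (opnormZ_le _ _))// normcN normc1 mul1r. Qed.

Lemma opnormM A B : opnorm (A *m B) <= opnorm A * opnorm B.
Proof.
apply: opnorm_le => [|x]; first by rewrite mulr_ge0 ?opnorm_ge0.
rewrite -mulmxA -mulrA (le_trans (vnorm_mulmx _ _))// ler_wpM2l ?opnorm_ge0//.
exact: vnorm_mulmx.
Qed.

(** The constant 2 is what makes [1/2] the least cost for a matrix of norm 1. *)
Lemma opnorm_commutator A B : opnorm (commutator A B) <= 2 * (opnorm A * opnorm B).
Proof.
apply: le_trans (opnormD _ _) _; rewrite mulr_natl mulr2n lerD ?opnormM//.
by rewrite (le_trans (opnormN_le _))// mulrC opnormM.
Qed.

Lemma sqr_col_le A j : \sum_i normc (A i j) ^+ 2 <= opnorm A ^+ 2.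
Proof.
have d1 : vnorm (delta_mx j 0 : 'cV[C]_n) = 1.
  rewrite /vnorm (bigD1 j)//= mxE !eqxx normc1 expr1n big1 ?addr0 ?sqrtr1// => i ij.
  by rewrite mxE (negbTE ij) normc0 expr0n.
have := vnorm_mulmx A (delta_mx j 0); rewrite d1 mulr1 => h.
have -> : \sum_i normc (A i j) ^+ 2 = vnorm (A *m delta_mx j 0) ^+ 2.
  by rewrite sqr_vnorm -colE; apply: eq_bigr => i _; rewrite mxE.
by rewrite ler_sqr ?nnegrE ?vnorm_ge0 ?opnorm_ge0.
Qed.

(** The squared Frobenius norm is the sum of the squared lengths of [n] columns. *)
Lemma frobenius_le A : \sum_i \sum_j normc (A i j) ^+ 2 <= n%:R * opnorm A ^+ 2.
Proof.
rewrite exchange_big /= (@le_trans _ _ (\sum_(j < n) opnorm A ^+ 2))//.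
  by apply: ler_sum => j _; apply: sqr_col_le.
by rewrite sumr_const card_ord mulr_natl.
Qed.

Lemma normc_le_opnorm A i j : normc (A i j) <= opnorm A.
Proof.
rewrite -ler_sqr ?nnegrE ?normc_ge0 ?opnorm_ge0//; apply: le_trans (sqr_col_le A j).
by rewrite (bigD1 i)//= lerDl sumr_ge0// => l _; rewrite sqr_ge0.
Qed.

(** [||x||^2 = x^* x], so a multiple of an isometry scales every norm. *)
Lemma vnorm_adjoint x : (x ^t*) *m x = (vnorm x ^+ 2)%:C%:M.
Proof.
apply/matrixP => a b; rewrite !ord1 mxE sqr_vnorm !mxE eqxx rmorph_sum mulr1n /=.
by apply: eq_bigr => i _; rewrite !mxE sqr_normcE add_Re2_Im2 sqr_normc mulrC.
Qed.

Lemma vnorm_scaled_isometry A c : 0 <= c -> A ^t* *m A = (c ^+ 2)%:C%:M ->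
  forall x, vnorm (A *m x) = c * vnorm x.
Proof.
move=> c0 h x; apply/eqP; rewrite -(@eqrXn2 _ 2)// ?mulr_ge0 ?vnorm_ge0//.
have := vnorm_adjoint (A *m x); rewrite trmx_mul map_mxM.
rewrite mulmxA -[_ *m _ *m A]mulmxA h -mulmxA mul_scalar_mx -scalemxAr.
rewrite vnorm_adjoint => /matrixP/(_ 0 0); rewrite !mxE eqxx !mulr1n.
by rewrite -rmorphM /= exprMn => -[->].
Qed.

Lemma opnorm_scaled_isometry_le A c : 0 <= c -> A ^t* *m A = (c ^+ 2)%:C%:M ->
  opnorm A <= c.
Proof.
by move=> c0 h; apply: opnorm_le => // x; rewrite (vnorm_scaled_isometry c0 h).
Qed.

Lemma opnorm_scaled_isometry A c : (0 < n)%N -> 0 <= c ->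
  A ^t* *m A = (c ^+ 2)%:C%:M -> opnorm A = c.
Proof.
move=> n0 c0 h; apply/eqP; rewrite eq_le opnorm_scaled_isometry_le//=.
rewrite -ler_sqr ?nnegrE ?opnorm_ge0//; apply: le_trans (sqr_col_le A (Ordinal n0)).
move/matrixP/(_ (Ordinal n0) (Ordinal n0)): h; rewrite !mxE eqxx mulr1n => h.
rewrite -lecR -h rmorph_sum /= le_eqVlt; apply/orP; left.
apply/eqP; apply: eq_bigr => i _.
by rewrite !mxE sqr_normcE add_Re2_Im2 sqr_normc mulrC.
Qed.

End Opnorm.

(** Extending a vector by zero outside [S] is isometric, and restricting to
    [S] is contractive; a principal submatrix is the matrix between the two. *)
Lemma opnorm_principal_submx_le n (A : 'M[C]_n) (S : {set 'I_n}) :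
  opnorm (principal_submx A S) <= opnorm A.
Proof.
apply: opnorm_le => [|x]; first exact: opnorm_ge0.
pose E : 'M[C]_(n, #|S|) := \matrix_(i, a) (i == enum_val a)%:R.
have mulE m (Y : 'M[C]_(m, n)) r b : (Y *m E) r b = Y r (enum_val b).
  rewrite mxE (bigD1 (enum_val b))//= mxE eqxx mulr1 big1 ?addr0// => i /negbTE ib.
  by rewrite mxE ib mulr0.
have mulTE m (Y : 'M[C]_(n, m)) a c : (E^T *m Y) a c = Y (enum_val a) c.
  by rewrite -[Y in LHS]trmxK -trmx_mul mxE mulE mxE.
have -> : principal_submx A S *m x = E^T *m (A *m (E *m x)).
  by rewrite !mulmxA; congr (_ *m x); apply/matrixP => a b; rewrite mulE mulTE mxE.
have sum_val (f : 'I_n -> R) : \sum_(i in S) f i = \sum_(a < #|S|) f (enum_val a).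
  by rewrite big_enum_val.
have restr (y : 'cV[C]_n) : vnorm (E^T *m y) <= vnorm y.
  apply: vnorm_sqr_le; rewrite [leRHS](bigID (mem S))/= sum_val.
  rewrite -[leLHS]addr0 lerD ?sumr_ge0// => [|i _]; last by rewrite sqr_ge0.
  by apply: ler_sum => a _; rewrite mulTE.
have ext : vnorm (E *m x) <= vnorm x.
  apply: vnorm_sqr_le; rewrite (bigID (mem S))/= sum_val [X in _ + X]big1.
    rewrite addr0; apply: ler_sum => a _; rewrite mxE (bigD1 a)//= !mxE eqxx mul1r.
    rewrite big1 ?addr0// => b /negbTE ba.
    by rewrite mxE (inj_eq enum_val_inj) eq_sym ba mul0r.
  move=> i iS; rewrite mxE big1 ?normc0 ?expr0n// => a _; rewrite mxE.
  by case: eqP => [ia|]; [rewrite ia enum_valP in iS|rewrite mul0r].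
apply: le_trans (restr _) _; apply: le_trans (vnorm_mulmx _ _) _.
by rewrite ler_wpM2l ?opnorm_ge0.
Qed.
End Norms.

(** * The matrices S and their dyadic blocks *)

Section SquareCast.
Variables (K : comNzRingType) (n m : nat) (e : n = m).
Implicit Types M N : 'M[K]_n.

Lemma castmx_mul M N :
  castmx (e, e) (M *m N) = castmx (e, e) M *m castmx (e, e) N.
Proof. by case: m / e. Qed.

Lemma castmx_opp M : castmx (e, e) (- M) = - castmx (e, e) M.
Proof. by case: m / e. Qed.

Lemma castmx_scalar a : castmx (e, e) (a%:M : 'M[K]_n) = a%:M.
Proof. by case: m / e. Qed.
End SquareCast.

Section Family.
Local Open Scope sesquilinear_scope.
Variable R : realType.
Local Notation C := R[i].
Local Notation Smx := (Smx R).
Local Notation conjC := Num.conj.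

Lemma Smx_tr k : (Smx k)^T = - Smx k.
Proof.
elim: k => [|k IH]; first by rewrite trmx0 oppr0.
rewrite /= trmx_cast /= tr_block_mx !linearD !linearN /= tr_scalar_mx IH.
by rewrite -castmx_opp opp_block_mx !opprD !opprK.
Qed.

Lemma Smx_conj k : (Smx k) ^ conjC = Smx k.
Proof.
elim: k => [|k IH]; first by rewrite map_mx0.
rewrite /= map_castmx map_block_mx map_mxD map_mxB map_mxN IH map_mx1.
by [].
Qed.

Lemma doubling_sqr n (S : 'M[C]_n) c : S *m S = (1 - c)%:M ->
  let M := block_mx S (S + 1%:M) (S - 1%:M) (- S) in M *m M = (1 - 2 * c)%:M.
Proof.
move=> h; rewrite /= mulmx_block scalar_mx_block.
rewrite !mulmxDl !mulmxDr !mulNmx !mulmxN !mul1mx !mulmx1 !opprK h.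
congr (block_mx _ _ _ _); apply/matrixP => i j; rewrite !mxE.
all: by move: (S i j) => u; case: (i == j); rewrite ?mulr1n ?mulr0n; ring.
Qed.

Lemma Smx_sqr k : Smx k *m Smx k = (1 - (2 ^ k)%:R)%:M.
Proof.
elim: k => [|k IH]; first by rewrite mul0mx expn0 subrr raddf0.
rewrite /= -castmx_mul (doubling_sqr IH) castmx_scalar.
by rewrite expnS natrM.
Qed.

Lemma Smx_diag k i : Smx k i i = 0.
Proof.
elim: k i => [|k IH] i; first by rewrite mxE.
rewrite /= castmxE; set e := esym _.
case: (split_ordP (cast_ord e i)) => a ->.
  by rewrite block_mxEul IH.
by rewrite block_mxEdr mxE IH oppr0.
Qed.

(** The shifts by [1%:M] and [- 1%:M] fill the zero diagonals of the two
    off-diagonal blocks with signs. *)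
Lemma normc_Smx k i j : normc (Smx k i j) = (i != j)%:R.
Proof.
elim: k i j => [|k IH] i j; first by rewrite mxE normc0 !ord1.
have diag a : normc (Smx k a a) = 0 by rewrite Smx_diag normc0.
rewrite /= castmxE; set e := esym _.
rewrite -(inj_eq (@cast_ord_inj _ _ e)).
case: (split_ordP (cast_ord e i)) => a ->; case: (split_ordP (cast_ord e j)) => b ->.
- by rewrite block_mxEul IH (inj_eq (@lshift_inj _ _)).
- rewrite block_mxEur !mxE eq_lrshift.
  case: (eqVneq a b) => [->|ab]; first by rewrite Smx_diag add0r normc1.
  by rewrite addr0 IH ab.
- rewrite block_mxEdl !mxE eq_rlshift.
  case: (eqVneq a b) => [->|ab]; first by rewrite Smx_diag add0r normcN normc1.
  by rewrite subr0 IH ab.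
- by rewrite block_mxEdr mxE normcN IH (inj_eq (@rshift_inj _ _)).
Qed.

(** Cutting [S] down to its dyadic blocks does not change the principal submatrix
    on a block, and turns the norm bound for all blocks into one identity. *)
Definition dyadic_part d k : 'M[C]_(2 ^ k) :=
  \matrix_(i, j) if (i %/ 2 ^ d == j %/ 2 ^ d)%N then Smx k i j else 0.

Lemma dyadic_part_tr d k : (dyadic_part d k)^T = - dyadic_part d k.
Proof.
apply/matrixP => i j; rewrite !mxE eq_sym; case: ifP; rewrite ?oppr0// => _.
by have /matrixP/(_ i j) := Smx_tr k; rewrite !mxE.
Qed.

Lemma dyadic_part_conj d k : (dyadic_part d k) ^ conjC = dyadic_part d k.
Proof.
apply/matrixP => i j; rewrite !mxE; case: ifP; rewrite ?rmorph0// => _.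
by have /matrixP/(_ i j) := Smx_conj k; rewrite !mxE.
Qed.

Lemma dyadic_part_full d : dyadic_part d d = Smx d.
Proof. by apply/matrixP => i j; rewrite !mxE !divn_small. Qed.

Lemma dyadic_partS d k : (d <= k)%N ->
  dyadic_part d k.+1 = castmx (double_pow2 k, double_pow2 k)
    (block_mx (dyadic_part d k) 0 0 (- dyadic_part d k)).
Proof.
move=> dk; apply/matrixP => i j; rewrite mxE /= !castmxE /=; set e := esym _.
have vi : i = cast_ord e i :> nat by [].
have vj : j = cast_ord e j :> nat by [].
have shift (a : 'I_(2 ^ k)) : ((2 ^ k + a) %/ 2 ^ d = 2 ^ (k - d) + a %/ 2 ^ d)%N.
  by rewrite -{1}(subnK dk) expnD divnMDl ?expn_gt0.
have small (a : 'I_(2 ^ k)) : (a %/ 2 ^ d < 2 ^ (k - d))%N.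
  by rewrite ltn_divLR ?expn_gt0// -expnD subnK.
rewrite [in X in if X then _ else _]vi [in X in if X then _ else _]vj.
case: (split_ordP (cast_ord e i)) => a ->; case: (split_ordP (cast_ord e j)) => b ->;
  rewrite ?block_mxEul ?block_mxEur ?block_mxEdl ?block_mxEdr !mxE /= ?shift.
- by [].
- by rewrite ltn_eqF// (leq_trans (small a))// leq_addr.
- by rewrite eq_sym ltn_eqF// (leq_trans (small b))// leq_addr.
- by rewrite eqn_add2l; case: ifP; rewrite ?oppr0.
Qed.

(** Doubling [n] puts [S_n] and [- S_n] on the diagonal, so the dyadic part
    inherits its square from the smaller sizes, down to [S_(2^d)] itself. *)
Lemma dyadic_part_sqr d k : (d <= k)%N ->
  dyadic_part d k *m dyadic_part d k = (1 - (2 ^ d)%:R)%:M.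
Proof.
move=> /subnK <-; elim: (k - d)%N => [|l IH].
  by rewrite add0n dyadic_part_full Smx_sqr.
rewrite addSn dyadic_partS ?leq_addl// -castmx_mul mulmx_block.
rewrite !mulmx0 !mul0mx !addr0 !add0r mulmxN mulNmx opprK IH.
by rewrite -scalar_mx_block castmx_scalar.
Qed.

End Family.

(** * Unitarity and paving *)

Section Paving.
Local Open Scope sesquilinear_scope.
Variables (R : realType) (k : nat).
Local Notation C := R[i].
Local Notation conjC := Num.conj.
Local Notation A := (Amx R k).
Local Notation N := ((2 ^ k)%:R : R).
Local Notation alpha := ('i / (Num.sqrt (N - 1))%:C : C).

Lemma pow2_ge1 l : 1 <= (2 ^ l)%:R :> R.
Proof. by rewrite ler1n expn_gt0. Qed.

Lemma conj_alpha : conjC alpha = - alpha.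
Proof.
rewrite rmorphM fmorphV /= -mulNr; congr (_ / _).
  by apply/eqP; rewrite eq_complex /= oppr0 !eqxx.
by apply/eqP; rewrite eq_complex /= oppr0 !eqxx.
Qed.

Lemma adjoint_scaled_skew (T : 'M[C]_(2 ^ k)) :
  T^T = - T -> T ^ conjC = T -> (alpha *: T) ^t* = alpha *: T.
Proof.
move=> hT hc; rewrite linearZ /= hT map_mxZ map_mxN hc.
by rewrite [X in X *: _]conj_alpha scalerN scaleNr opprK.
Qed.

Lemma Amx_adjoint : A ^t* = A.
Proof. exact: adjoint_scaled_skew (Smx_tr R k) (Smx_conj R k). Qed.

Lemma Amx_diag i : A i i = 0.
Proof. by rewrite mxE Smx_diag mulr0. Qed.

Lemma Amx_herm : A \is hermsymmx.
Proof. by apply/is_hermitianmxP; rewrite expr0 scale1r Amx_adjoint. Qed.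

Hypothesis k_gt0 : (0 < k)%N.

Lemma pow2_sub1_gt0 : 0 < N - 1.
Proof. by rewrite subr_gt0 ltr1n -(expn0 2) ltn_exp2l. Qed.

Lemma alpha_sqr : alpha ^+ 2 = (- (N - 1)^-1)%:C.
Proof.
rewrite exprMn exprVn -rmorphXn sqr_sqrtr ?(ltW pow2_sub1_gt0)// sqr_i mulN1r.
by rewrite rmorphN fmorphV.
Qed.

Lemma scaled_skew_sqr (T : 'M[C]_(2 ^ k)) m : T *m T = (1 - m%:R)%:M ->
  (alpha *: T) *m (alpha *: T) = ((m%:R - 1) / (N - 1))%:C%:M.
Proof.
move=> hT; rewrite -scalemxAl -scalemxAr scalerA hT -expr2 alpha_sqr scale_scalar_mx.
congr (_%:M); have -> : 1 - m%:R = (1 - m%:R)%:C :> C.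
  by rewrite rmorphB rmorph1 rmorph_nat.
by rewrite -rmorphM mulNr -mulrN opprB mulrC.
Qed.

Lemma Amx_sqr : A *m A = 1%:M.
Proof.
rewrite (scaled_skew_sqr (Smx_sqr R k)) divff ?gt_eqF ?pow2_sub1_gt0//.
Qed.

Lemma Amx_unitary : A \is unitarymx.
Proof. by apply/unitarymxP; rewrite Amx_adjoint Amx_sqr. Qed.

Lemma opnorm_Amx : opnorm A = 1.
Proof.
apply: opnorm_scaled_isometry; rewrite ?expn_gt0 ?ler01//.
by rewrite Amx_adjoint Amx_sqr expr1n.
Qed.

Lemma sqr_normc_Amx i j : normc (A i j) ^+ 2 = (i != j)%:R / (N - 1).
Proof.
rewrite mxE normcM normc_Smx exprMn [RHS]mulrC; congr (_ * _).
  rewrite normcM normcV normc_real exprMn exprVn sqr_normcE /= expr0n add0r expr1n.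
  by rewrite mul1r real_normK ?num_real// sqr_sqrtr// ltW// pow2_sub1_gt0.
by case: (_ != _); rewrite ?expr1n ?expr0n.
Qed.

(** A single column of [A_S] already has squared length [(#|S| - 1) / (n - 1)]. *)
Lemma principal_Amx_ge (S : {set 'I_(2 ^ k)}) : (0 < #|S|)%N ->
  Num.sqrt ((#|S|%:R - 1) / (N - 1)) <= opnorm (principal_submx A S).
Proof.
move=> S0; rewrite -[leRHS]ger0_norm ?opnorm_ge0// -sqrtr_sqr ler_wsqrtr//.
apply: le_trans (sqr_col_le _ (Ordinal S0)); set a := Ordinal S0.
rewrite (bigD1 a)//= mxE sqr_normc_Amx eqxx mul0r add0r.
rewrite (eq_bigr (fun=> (N - 1)^-1)) => [|i ia].
  rewrite sumr_const cardC1 card_ord -[leRHS]mulr_natl.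
  by rewrite -subn1 natrB.
by rewrite mxE sqr_normc_Amx (inj_eq enum_val_inj) ia mul1r.
Qed.

Definition dyadic_blocks l : {set {set 'I_(2 ^ k)}} :=
  preim_partition (fun i : 'I_(2 ^ k) => i %/ 2 ^ (k - l))%N (finset.setTfor 'I_(2 ^ k)).

Lemma dyadic_blocks_partition l :
  finset.partition (dyadic_blocks l) (finset.setTfor 'I_(2 ^ k)).
Proof. exact: preim_partitionP. Qed.

Lemma card_dyadic_blocks l : (l <= k)%N -> (#|dyadic_blocks l| <= 2 ^ l)%N.
Proof.
move=> lk; rewrite -[X in (_ <= X)%N]card_ord.
pose F (q : 'I_(2 ^ l)) := finset.finset (fun i : 'I_(2 ^ k) => i %/ 2 ^ (k - l) == q)%N.
apply: leq_trans (leq_imset_card F _); apply: subset_leq_card.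
apply/fintype.subsetP => S /imsetP[x _ ->].
have xl : (x %/ 2 ^ (k - l) < 2 ^ l)%N.
  by rewrite ltn_divLR ?expn_gt0// -expnD subnKC.
apply/imsetP; exists (Ordinal xl) => //; apply/setP => i.
by rewrite !finset.inE /= eq_sym.
Qed.

Lemma dyadic_block_norm l (S : {set 'I_(2 ^ k)}) : S \in dyadic_blocks l ->
  opnorm (principal_submx A S) <= Num.sqrt (((2 ^ (k - l))%:R - 1) / (N - 1)).
Proof.
move=> /imsetP[x _ eS].
have same (a b : 'I_(#|S|)) : (enum_val a %/ 2 ^ (k - l) == enum_val b %/ 2 ^ (k - l))%N.
  have := enum_valP a; have := enum_valP b; rewrite {2 4}eS !finset.inE /=.
  by move=> /eqP <- /eqP <-.
have -> : principal_submx A S = principal_submx (alpha *: dyadic_part R (k - l) k) S.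
  by apply/matrixP => a b; rewrite !mxE same.
apply: le_trans (opnorm_principal_submx_le _ _) _.
apply: opnorm_scaled_isometry_le; first exact: sqrtr_ge0.
rewrite adjoint_scaled_skew ?dyadic_part_tr ?dyadic_part_conj//.
rewrite (scaled_skew_sqr (dyadic_part_sqr R (leq_subr l k))) sqr_sqrtr//.
by rewrite divr_ge0 ?(ltW pow2_sub1_gt0)// subr_ge0 pow2_ge1.
Qed.

Lemma dyadic_paving_norm_le l :
  paving_norm A (dyadic_blocks l) <= Num.sqrt (((2 ^ (k - l))%:R - 1) / (N - 1)).
Proof. by apply: bigmax_le => [|S]; [exact: sqrtr_ge0|exact: dyadic_block_norm]. Qed.

(** By the pigeonhole principle some block has at least [2 ^ (k - l)] elements. *)
Lemma paving_norm_ge l (P : {set {set 'I_(2 ^ k)}}) : (l <= k)%N ->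
  finset.partition P (finset.setTfor 'I_(2 ^ k)) -> (#|P| <= 2 ^ l)%N ->
  Num.sqrt (((2 ^ (k - l))%:R - 1) / (N - 1)) <= paving_norm A P.
Proof.
move=> lk Ppart Pr.
have [S SP Sm] : exists2 S, S \in P & (2 ^ (k - l) <= #|S|)%N.
  apply/exists_inP; apply: contraT; rewrite negb_exists_in => /forall_inP small.
  have := card_partition Ppart; rewrite cardsT card_ord => /eqP; rewrite eqn_leq.
  case/andP => + _; rewrite leqNgt => /negP; case.
  apply: (@leq_ltn_trans (\sum_(S in P) (2 ^ (k - l)).-1)).
    apply: leq_sum => S /small; rewrite -ltnNge => h.
    by rewrite -ltnS prednK ?expn_gt0.
  rewrite sum_nat_const (@leq_ltn_trans (2 ^ l * (2 ^ (k - l)).-1))//.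
    by rewrite leq_mul2r Pr orbT.
  by rewrite -[in ltnRHS](subnKC lk) expnD ltn_pmul2l ?expn_gt0// ltn_predL expn_gt0.
apply: (@le_trans _ _ (opnorm (principal_submx A S))); last exact: le_bigmax_cond.
apply: le_trans (principal_Amx_ge _); last by rewrite (leq_trans _ Sm)// expn_gt0.
by rewrite ler_wsqrtr// ler_wpM2r ?invr_ge0 ?(ltW pow2_sub1_gt0)// lerB// ler_nat.
Qed.

Lemma natr_pow2_div l : (l <= k)%N -> N / (2 ^ l)%:R = (2 ^ (k - l))%:R.
Proof.
move=> lk; rewrite -[in N](subnK lk) expnD natrM mulfK//.
by rewrite pnatr_eq0 -lt0n expn_gt0.
Qed.

Lemma paving_number_Amx l : (l <= k)%N ->
  paving_number (2 ^ l) A = Num.sqrt ((N / (2 ^ l)%:R - 1) / (N - 1)).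
Proof.
move=> lk; rewrite natr_pow2_div//; apply: minimumE; split; last first.
  by move=> _ [P [Ppart Pr] <-]; exact: paving_norm_ge.
exists (dyadic_blocks l).
  by split; [exact: dyadic_blocks_partition|exact: card_dyadic_blocks].
apply/eqP; rewrite eq_le dyadic_paving_norm_le paving_norm_ge//.
  exact: dyadic_blocks_partition.
exact: card_dyadic_blocks.
Qed.

(** The number of blocks is the least power of two that is at least
    [eps ^- 2], capped at [n]: with [n] blocks every block is a singleton. *)
Lemma exists_paving_Amx (eps : R) : 0 < eps -> eps < 1 ->
  exists2 P : {set {set 'I_(2 ^ k)}}, is_paving eps A P & #|P|%:R < 2 * eps ^- 2.
Proof.
move=> e0 e1; set t := eps ^- 2.
have t1 : 1 < t by rewrite invf_gt1 ?exprn_gt0// exprn_ilt1// ltW.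
have ex : exists l, t <= (2 ^ l)%:R.
  exists (Num.truncn t).+1; apply: ltW; apply: lt_le_trans (truncnS_gt _) _.
  by rewrite ler_nat ltnW// ltn_expl.
case: (ex_minnP ex) => l tl lmin.
have l2t : (2 ^ l)%:R < 2 * t.
  case: l tl lmin => [|l] tl lmin; first by lra.
  rewrite expnS natrM ltr_pM2l ?ltr0n// ltNge; apply/negP => /lmin.
  by rewrite ltnn.
pose d := minn l k; have dk : (d <= k)%N by rewrite geq_minr.
exists (dyadic_blocks d); last first.
  apply: le_lt_trans l2t; rewrite ler_nat (leq_trans (card_dyadic_blocks dk))//.
  by rewrite leq_exp2l// geq_minl.
split; first exact: dyadic_blocks_partition.
apply: le_trans (dyadic_paving_norm_le _) _; rewrite opnorm_Amx mulr1.
rewrite -[leRHS]ger0_norm ?(ltW e0)// -sqrtr_sqr ler_wsqrtr//.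
have e2 : eps ^+ 2 = t^-1 by rewrite invrK.
rewrite ler_pdivrMr ?pow2_sub1_gt0//.
have [kl|lk] := leqP k l.
  rewrite /d (minn_idPr kl) subnn expn0 subrr.
  by rewrite mulr_ge0 ?sqr_ge0// ltW// pow2_sub1_gt0.
rewrite /d (minn_idPl (ltnW lk)) -natr_pow2_div ?(ltnW lk)// e2.
have t0 : 0 < t by apply: lt_trans t1; rewrite ltr01.
have p0 : 0 < (2 ^ l)%:R :> R by rewrite ltr0n expn_gt0.
have h1 : N / (2 ^ l)%:R <= N / t by rewrite ler_wpM2l// lef_pV2 ?posrE.
have h2 : t^-1 <= 1 by rewrite invf_le1 ?ltW.
by rewrite mulrBr mulr1 mulrC; rewrite [t^-1 * N]mulrC; lra.
Qed.
End Paving.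

(** * Commutators of normal matrices *)

Section NormalCommutator.
Local Open Scope sesquilinear_scope.
Variables (R : realType) (k : nat).
Local Notation C := R[i].
Local Notation conjC := Num.conj.
Local Notation A := (Amx R k).
Hypothesis k_gt0 : (0 < k)%N.

(** [S_(2n) = S_n (x) (Z + X) + I_n (x) (i Y)] in terms of the Pauli matrices
    [X], [Y], [Z], and [(Z - X) / sqrt 2] is a reflection anticommuting with both
    [Z + X] and [Y]. *)
Lemma exists_anticommuting_reflection :
  exists B : 'M[C]_(2 ^ k), [/\ B ^t* = B, B *m B = 1%:M & B *m A = - (A *m B)].
Proof.
case: k k_gt0 => // k' _.
pose B0 : 'M[C]_(2 ^ k' + 2 ^ k') := block_mx 1%:M (- 1%:M) (- 1%:M) (- 1%:M).
pose c : C := ((Num.sqrt 2)^-1 : R)%:C.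
have cc : c * c + c * c = 1.
  rewrite -rmorphM -rmorphD /= -expr2 exprVn sqr_sqrtr ?ler0n//.
  by rewrite -[_^-1]mul1r -splitr.
have BS n (S : 'M[C]_n) (M := block_mx S (S + 1%:M) (S - 1%:M) (- S))
    (B := block_mx 1%:M (- 1%:M) (- 1%:M) (- 1%:M)) : B *m M = - (M *m B).
  rewrite /B /M !mulmx_block opp_block_mx !mulmxN !mulNmx !mulmx1 !mul1mx.
  congr (block_mx _ _ _ _); apply/matrixP => i j; rewrite !mxE;
    by move: (S i j) => u; case: (i == j); rewrite ?mulr1n ?mulr0n; ring.
have BB n (B := block_mx 1%:M (- 1%:M) (- 1%:M) (- 1%:M) : 'M[C]_(n + n)) :
    B *m B = 2%:M.
  rewrite /B mulmx_block scalar_mx_block !mulmxN !mulNmx !mulmx1.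
  congr (block_mx _ _ _ _); apply/matrixP => i j; rewrite !mxE;
    by case: (i == j); rewrite ?mulr1n ?mulr0n; ring.
exists (c *: castmx (double_pow2 k', double_pow2 k') B0); split.
- rewrite linearZ /= trmx_cast /= tr_block_mx !linearN /= !tr_scalar_mx.
  rewrite map_mxZ map_castmx map_block_mx !map_mxN map_mx1; congr (_ *: _).
  by apply/eqP; rewrite eq_complex /= oppr0 !eqxx.
- rewrite -scalemxAl -scalemxAr scalerA -castmx_mul BB castmx_scalar.
  by rewrite scale_scalar_mx mulr_natr mulr2n cc.
- rewrite -!scalemxAl -!scalemxAr -!castmx_mul BS castmx_opp.
  by rewrite !scalerN scalerA [c * _]mulrC -scalerA.
Qed.

Lemma normal_commutator_costs_Amx : is_minimum (normal_commutator_costs A) (1 / 2).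
Proof.
split; last first.
  move=> _ [B [D [_ _ AE ->]]]; rewrite ler_pdivrMr// mulrC.
  by have := opnorm_commutator B D; rewrite -AE opnorm_Amx.
have [B [Badj BB BA]] := exists_anticommuting_reflection.
have AA := Amx_sqr R k_gt0; have Aadj := Amx_adjoint R k.
pose h : C := (1 / 2 : R)%:C.
have hh : h + h = 1 by rewrite -rmorphD /= -splitr.
pose D := h *: (B *m A).
have Dadj : D ^t* = - D.
  rewrite /D linearZ /= trmx_mul map_mxZ map_mxM Aadj Badj BA -scalerN opprK.
  by congr (_ *: _); apply/eqP; rewrite eq_complex /= oppr0 !eqxx.
exists B, D; split.
- by apply/normalmxP; rewrite Badj.
- by apply/normalmxP; rewrite Dadj mulmxN mulNmx.
- rewrite /commutator /D -scalemxAr -scalemxAl mulmxA BB mul1mx -scalerBr.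
  by rewrite BA mulNmx opprK -mulmxA BB mulmx1 scalerDr -scalerDl hh scale1r.
have -> : opnorm B = 1.
  by apply: opnorm_scaled_isometry; rewrite ?expn_gt0 ?ler01// Badj BB expr1n.
rewrite [RHS]mul1r; apply: esym; apply: opnorm_scaled_isometry;
  rewrite ?expn_gt0 ?divr_ge0 ?ler01 ?ler0n//.
rewrite Dadj mulNmx /D -scalemxAl -scalemxAr scalerA.
have -> : B *m A *m (B *m A) = - 1%:M.
  by rewrite [in X in X *m _]BA mulNmx -mulmxA (mulmxA B) BB mul1mx AA.
by rewrite scalerN opprK expr2 rmorphM scale_scalar_mx mulr1.
Qed.
End NormalCommutator.

(** * Inverse-square energy of points in a square *)

Section Energy.
Variable R : realType.

(** The endpoint [t = 1] is put in the last of the [2 ^ L] intervals. *)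
Definition dyadic_cell L (t : R) : nat :=
  minn (Num.truncn ((t + 1) / 2 * (2 ^ L)%:R)) (2 ^ L).-1.

Lemma dyadic_cell_lt L t : (dyadic_cell L t < 2 ^ L)%N.
Proof.
rewrite /dyadic_cell (@leq_ltn_trans (2 ^ L).-1)// ?geq_minr//.
by rewrite ltn_predL expn_gt0.
Qed.

Lemma dyadic_cell_bounds L (t : R) : `|t| <= 1 ->
  (dyadic_cell L t)%:R <= (t + 1) / 2 * (2 ^ L)%:R <= (dyadic_cell L t)%:R + 1.
Proof.
rewrite ler_norml => /andP[t1 t2]; rewrite /dyadic_cell.
have p0 : 0 < (2 ^ L)%:R :> R by rewrite ltr0n expn_gt0.
set u := (t + 1) / 2 * _; have u0 : 0 <= u by rewrite mulr_ge0 ?(ltW p0)//; lra.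
have uL : u <= (2 ^ L)%:R by rewrite ler_piMl ?(ltW p0)//; lra.
have /andP[h1 h2] := truncn_itv u0.
rewrite /minn; case: ltnP => h; first by rewrite h1 natr1 ltW.
apply/andP; split; first by apply: le_trans h1; rewrite ler_nat.
by rewrite natr1 prednK ?expn_gt0.
Qed.

(** A cell is an interval of length [2 / 2 ^ L]; the bound is squared because the
    two coordinates are added to a squared distance. *)
Lemma dyadic_cell_close L (s t : R) : `|s| <= 1 -> `|t| <= 1 ->
  dyadic_cell L s = dyadic_cell L t -> (s - t) ^+ 2 * (4 ^ L)%:R <= 4.
Proof.
move=> /(dyadic_cell_bounds L) hs /(dyadic_cell_bounds L) ht e.
move: hs ht; rewrite e; move: (dyadic_cell L t)%:R => c /andP[s1 s2] /andP[t1 t2].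
have -> : (4 ^ L)%:R = (2 ^ L)%:R ^+ 2 :> R by rewrite -natrX -expnM mulnC expnM.
move: (2 ^ L)%:R s1 s2 t1 t2 => p s1 s2 t1 t2.
rewrite -exprMn.
have : `|(s - t) * p| <= 2 by rewrite ler_norml; apply/andP; split; lra.
have -> : (4 : R) = 2 ^+ 2 by ring.
by rewrite -[in X in _ -> X]real_normK ?num_real// ler_sqr ?nnegrE ?normr_ge0.
Qed.

(** Cauchy-Schwarz for the fibre sizes: they add up to [#|I|], and their squares add
    up to the number of ordered pairs with equal images. *)
Lemma card_fibre_pairs (I J : finType) (f : I -> J) :
  #|I|%:R ^+ 2 <= (\sum_i \sum_j (f i == f j)%:R) * #|J|%:R :> R.
Proof.
pose c (y : J) : R := \sum_i (f i == y)%:R.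
have Ec : \sum_y c y * 1 = #|I|%:R.
  under eq_bigr do rewrite mulr1.
  rewrite exchange_big /= -sum1_card natr_sum; apply: eq_bigr => i _.
  rewrite (bigD1 (f i))//= eqxx big1 ?addr0// => y.
  by rewrite eq_sym => /negbTE ->.
have Ecc : \sum_y c y ^+ 2 = \sum_i \sum_j (f i == f j)%:R.
  rewrite /c; under eq_bigr do rewrite expr2 big_distrl /=.
  rewrite exchange_big /=; apply: eq_bigr => i _.
  under eq_bigr do rewrite big_distrr /=.
  rewrite exchange_big /=; apply: eq_bigr => j _.
  rewrite (bigD1 (f i))//= eqxx mul1r eq_sym big1 ?addr0// => y.
  by rewrite eq_sym => /negbTE ->; rewrite mul0r.
have := sqr_sum_le c (fun=> 1); rewrite Ec Ecc; congr (_ <= _ * _).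
by rewrite expr1n sumr_const.
Qed.

Variables (I : finType) (x y : I -> R).
Hypotheses (x1 : forall i, `|x i| <= 1) (y1 : forall i, `|y i| <= 1).

Local Notation sqdist i j := ((x i - x j) ^+ 2 + (y i - y j) ^+ 2).

Definition same_cell L i j := (dyadic_cell L (x i) == dyadic_cell L (x j)) &&
  (dyadic_cell L (y i) == dyadic_cell L (y j)).

(** Telescoped so that it equals [4 ^ L] for nested cells, with [L <= K] the
    finest scale at which [i] and [j] share a cell. *)
Definition cell_weight K i j : R :=
  1 + \sum_(L < K) 3 * (4 ^ L)%:R * (same_cell L.+1 i j)%:R.

Lemma cell_weight_le K i j : cell_weight K i j <= (4 ^ K)%:R.
Proof.
elim: K => [|K IH]; first by rewrite /cell_weight big_ord0 addr0 expn0.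
rewrite /cell_weight big_ord_recr /= addrA expnS natrM.
have : 3 * (4 ^ K)%:R * (same_cell K.+1 i j)%:R <= 3 * (4 ^ K)%:R :> R.
  by rewrite ler_piMr ?mulr_ge0 ?ler0n// lern1 leq_b1.
by move: IH; rewrite /cell_weight; lra.
Qed.

Lemma cell_weight_diag K i : cell_weight K i i = (4 ^ K)%:R.
Proof.
elim: K => [|K IH]; first by rewrite /cell_weight big_ord0 addr0 expn0.
rewrite /cell_weight big_ord_recr /= addrA expnS natrM.
by move: IH; rewrite /cell_weight /same_cell !eqxx /= => ->; ring.
Qed.

(** If [L] is the finest level at which [i] and [j] share a cell, the weight is at
    most [4 ^ L], while the diameter of the cell bounds the squared distance by
    [8 / 4 ^ L]. *)
Lemma cell_weight_sqdist K i j : cell_weight K i j * sqdist i j <= 8.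
Proof.
have sq L : same_cell L i j -> sqdist i j * (4 ^ L)%:R <= 8.
  case/andP => /eqP hx /eqP hy; rewrite mulrDl.
  have := dyadic_cell_close (x1 i) (x1 j) hx.
  by have := dyadic_cell_close (y1 i) (y1 j) hy; lra.
have d0 : 0 <= sqdist i j by rewrite addr_ge0 ?sqr_ge0.
elim: K => [|K IH].
  rewrite /cell_weight big_ord0 addr0 mul1r -[leLHS]mulr1; apply: (sq 0).
  rewrite /same_cell; have cell0 t : dyadic_cell 0 t = 0%N.
    by apply/eqP; rewrite -leqn0 -ltnS dyadic_cell_lt.
  by rewrite !cell0.
have [s|s] := boolP (same_cell K.+1 i j).
  apply: le_trans (sq _ s); rewrite mulrC ler_wpM2l//; exact: cell_weight_le.
rewrite /cell_weight big_ord_recr /= (negbTE s) mulr0 addr0; exact: IH.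
Qed.

Lemma same_cell_pairs L :
  #|I|%:R ^+ 2 <= (4 ^ L)%:R * \sum_i \sum_j (same_cell L i j)%:R :> R.
Proof.
pose f i := (Ordinal (dyadic_cell_lt L (x i)), Ordinal (dyadic_cell_lt L (y i))).
have := card_fibre_pairs f; rewrite card_prod card_ord -expnMn mulrC.
by congr (_ <= _ * _).
Qed.

(** Summing [cell_weight k i j <= 8 / sqdist i j] over [i != j]: each of the [k]
    scales contributes at least [3 / 4 * n ^ 2] to the total weight, and the
    constant term of the weights, [n ^ 2], cancels the [n] diagonal pairs of weight
    [4 ^ k = n] each. *)
Lemma inverse_square_energy k : #|I| = (4 ^ k)%N ->
  (forall i j, i != j -> 0 < sqdist i j) ->
  3 * k%:R * #|I|%:R ^+ 2 / 32 <= \sum_i \sum_j (sqdist i j)^-1.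
Proof.
move=> cardI dist; set n : R := #|I|%:R.
have nE : n = (4 ^ k)%:R by rewrite /n cardI.
have ptw i j : cell_weight k i j - (i == j)%:R * n <= 8 * (sqdist i j)^-1.
  have [->|ij] := eqVneq i j.
    by rewrite cell_weight_diag -nE mul1r !subrr expr0n addr0 invr0 mulr0.
  by rewrite mul0r subr0 ler_pdivlMr ?dist// cell_weight_sqdist.
have step : \sum_i \sum_j (cell_weight k i j - (i == j)%:R * n)
    <= 8 * \sum_i \sum_j (sqdist i j)^-1.
  rewrite mulr_sumr; apply: ler_sum => i _; rewrite mulr_sumr; apply: ler_sum => j _.
  exact: ptw.
have diag : \sum_(i : I) \sum_(j : I) (i == j)%:R * n = n ^+ 2.
  rewrite (eq_bigr (fun=> n)) => [|i _].
    by rewrite sumr_const -/n expr2 mulr_natl.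
  rewrite (bigD1 i)//= eqxx mul1r big1 ?addr0// => j.
  by rewrite eq_sym => /negbTE ->; rewrite mul0r.
have tot : \sum_i \sum_j cell_weight k i j =
    n ^+ 2 + \sum_(L < k) 3 * (4 ^ L)%:R * \sum_i \sum_j (same_cell L.+1 i j)%:R.
  rewrite /cell_weight.
  under eq_bigr => i _ do rewrite big_split /= exchange_big /=.
  rewrite big_split /= [in X in _ + X]exchange_big /=; congr (_ + _).
    under eq_bigr do rewrite sumr_const.
    by rewrite sumr_const -/n -mulr_natl expr2.
  apply: eq_bigr => L _; rewrite mulr_sumr; apply: eq_bigr => i _.
  by rewrite mulr_sumr.
have lev : \sum_(L < k) 3 / 4 * n ^+ 2 <=
    \sum_(L < k) 3 * (4 ^ L)%:R * \sum_i \sum_j (same_cell L.+1 i j)%:R.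
  apply: ler_sum => L _; have := same_cell_pairs L.+1.
  rewrite expnS natrM -/n; move: (\sum_i _) (4 ^ L)%:R => u v; lra.
rewrite sumr_const card_ord -[leLHS]mulr_natl in lev.
move: step; under eq_bigr do rewrite sumrB; rewrite sumrB diag tot.
rewrite [n ^+ 2 + _]addrC addrK => /(le_trans lev); lra.
Qed.
End Energy.

(** * The diagonal commutator cost is attained *)

Section Attained.
Local Open Scope classical_set_scope.
Variables (R : realType) (m : nat).
Local Notation C := R[i].
Implicit Types A B D : 'M[C]_m.

Definition diagonal_commutator_factors A : set 'M[C]_m :=
  [set D | exists B, [/\ is_diag_mx B, forall i, in_square (B i i) & A = commutator B D]].

Lemma commutator_diag B D i j : is_diag_mx B ->
  commutator B D i j = (B i i - B j j) * D i j.
Proof.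
move=> /is_diag_mxP hB; rewrite !mxE (bigD1 i)//= big1 => [|l li]; last first.
  by rewrite hB ?mul0r// eq_sym.
rewrite (bigD1 j)//= big1 => [|l lj]; last by rewrite hB ?mulr0.
by rewrite !addr0 mulrBl [D i j * _]mulrC.
Qed.

(** A diagonal with distinct entries can be divided out entry by entry; the points
    [i / m] are distinct and lie in the unit square. *)
Lemma diagonal_commutator_factors_neq0 A : (forall i, A i i = 0) ->
  diagonal_commutator_factors A !=set0.
Proof.
move=> A0; pose b (i : 'I_m) : R := i%:R / m%:R.
have m0 (i : 'I_m) : (m%:R : R) != 0.
  by rewrite pnatr_eq0 -lt0n (leq_ltn_trans _ (ltn_ord i)).
pose B : 'M[C]_m := diag_mx (\row_i (b i)%:C).
have BE i : B i i = (b i)%:C by rewrite !mxE eqxx mulr1n.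
exists (\matrix_(i, j) (A i j / ((b i)%:C - (b j)%:C))), B; split.
- exact: diag_mx_is_diag.
- move=> i; rewrite BE; split; rewrite /= ?normr0 ?ler01//.
  rewrite ger0_norm ?divr_ge0 ?ler0n// ler_pdivrMr ?lt_def ?m0 ?ler0n//.
  by rewrite mul1r ler_nat ltnW.
- apply/matrixP => i j; rewrite commutator_diag ?diag_mx_is_diag// !BE mxE.
  have [->|ij] := eqVneq i j; first by rewrite A0 mul0r mulr0.
  rewrite mulrC divfK// -rmorphB fmorph_eq0 subr_eq0.
  apply: contra ij => /eqP /(mulIf _) h; apply/eqP/val_inj/eqP.
  by rewrite -(eqr_nat R) h// invr_eq0 m0.
Qed.

(** A pair (B, D) in real coordinates: the row None holds the diagonal of B, the
   rows Some i hold D, and the boolean selects real or imaginary parts. *)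
Local Notation coord := (option 'I_m * 'I_m * bool)%type.
Local Notation point := (prod_topology (fun _ : coord => R)).

Definition point_entry (p : point) o j : C := p (o, j, true) +i* p (o, j, false).
Definition point_diag (p : point) : 'M[C]_m := diag_mx (\row_j point_entry p None j).
Definition point_mx (p : point) : 'M[C]_m := \matrix_(i, j) point_entry p (Some i) j.

Lemma continuous_coord (q : coord) : continuous (fun p : point => p q).
Proof. exact: (@proj_continuous coord (fun=> R) q). Qed.

Lemma continuous_sum (T : topologicalType) (J : finType) (f : J -> T -> R) :
  (forall j, continuous (f j)) -> continuous (fun p => \sum_j f j p).
Proof.
move=> fc; apply: continuous_big => // -[a b].
by apply: cvgD; [exact: cvg_fst|exact: cvg_snd].
Qed.

Lemma continuous_sub (T : topologicalType) (f g : T -> R) :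
  continuous f -> continuous g -> continuous (fun p => f p - g p).
Proof. by move=> fc gc p; apply: cvgB; [exact: fc|exact: gc]. Qed.

Lemma continuous_add (T : topologicalType) (f g : T -> R) :
  continuous f -> continuous g -> continuous (fun p => f p + g p).
Proof. by move=> fc gc p; apply: cvgD; [exact: fc|exact: gc]. Qed.

Lemma continuous_mul (T : topologicalType) (f g : T -> R) :
  continuous f -> continuous g -> continuous (fun p => f p * g p).
Proof. by move=> fc gc p; apply: cvgM; [exact: fc|exact: gc]. Qed.

Lemma continuous_const (T : topologicalType) (c : R) : continuous (fun _ : T => c).
Proof. by move=> p; exact: cvg_cst. Qed.

Lemma opnorm_dist (A D : 'M[C]_m) :
  `|opnorm A - opnorm D| <= Num.sqrt (\sum_i \sum_j normc (A i j - D i j) ^+ 2).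
Proof.
have h (X Y : 'M[C]_m) : opnorm X - opnorm Y <=
    Num.sqrt (\sum_i \sum_j normc (X i j - Y i j) ^+ 2).
  rewrite lerBlDr -{1}(subrK Y X); apply: le_trans (opnormD _ _) _.
  rewrite lerD2r; apply: le_trans (opnorm_frobenius _) _.
  by under eq_bigr do under eq_bigr do rewrite !mxE.
rewrite ler_norml h andbT lerNl opprB.
apply: le_trans (h D A) _; rewrite ler_wsqrtr//; apply: ler_sum => i _.
by apply: ler_sum => j _; rewrite -normcN opprB.
Qed.

Lemma cvg_dominated_dist (T : topologicalType) (f g : T -> R) x :
  (forall p, `|f x - f p| <= g p) -> g p @[p --> x] --> 0 -> f p @[p --> x] --> f x.
Proof.
move=> fg g0; apply/cvgrPdist_le => e e0.
move/cvgrPdist_le/(_ e e0): g0; apply: filterS => p; apply: le_trans.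
by rewrite sub0r normrN; apply: le_trans (fg p) (ler_norm _).
Qed.

Lemma continuous_opnorm_point_mx : continuous (fun p : point => opnorm (point_mx p)).
Proof.
move=> p0; pose h (p : point) : R := \sum_i \sum_j
  ((p0 (Some i, j, true) - p (Some i, j, true)) ^+ 2 +
   (p0 (Some i, j, false) - p (Some i, j, false)) ^+ 2).
have hc : continuous h.
  apply: continuous_sum => i; apply: continuous_sum => j.
  have d q := continuous_sub (@continuous_const _ (p0 q)) (@continuous_coord q).
  exact: (continuous_add (continuous_mul (d _) (d _)) (continuous_mul (d _) (d _))).
have h0 : h p0 = 0.
  by rewrite /h big1// => i _; rewrite big1// => j _; rewrite !subrr !expr0n addr0.
have sc : Num.sqrt (h p) @[p --> p0] --> 0.
  rewrite -[X in _ --> X](@sqrtr0 R) -h0.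
  by apply: cvg_comp; [exact: hc|exact: sqrt_continuous].
apply: cvg_dominated_dist sc => p; apply: le_trans (opnorm_dist _ _) _.
rewrite ler_wsqrtr// /h le_eqVlt; apply/orP; left; apply/eqP.
apply: eq_bigr => i _; apply: eq_bigr => j _.
by rewrite !mxE sqr_normcE.
Qed.

(** The equation is polynomial in the coordinates: it says that the sum [g] of
    the squared real and imaginary parts of all entries vanishes. *)
Lemma closed_commutator_eq A :
  closed [set p : point | A = commutator (point_diag p) (point_mx p)].
Proof.
pose re (p : point) i j :=
  (p (None, i, true) - p (None, j, true)) * p (Some i, j, true)
  - (p (None, i, false) - p (None, j, false)) * p (Some i, j, false)
  - complex.Re (A i j).
pose im (p : point) i j :=
  (p (None, i, true) - p (None, j, true)) * p (Some i, j, false)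
  + (p (None, i, false) - p (None, j, false)) * p (Some i, j, true)
  - complex.Im (A i j).
pose g (p : point) := \sum_i \sum_j (re p i j ^+ 2 + im p i j ^+ 2).
have gc : continuous g.
  apply: continuous_sum => i; apply: continuous_sum => j.
  have bc q r s := continuous_mul
    (continuous_sub (@continuous_coord q) (@continuous_coord r)) (@continuous_coord s).
  have rec := continuous_sub (continuous_sub
    (bc (None, i, true) (None, j, true) (Some i, j, true))
    (bc (None, i, false) (None, j, false) (Some i, j, false)))
    (@continuous_const _ (complex.Re (A i j))).
  have imc := continuous_sub (continuous_add
    (bc (None, i, true) (None, j, true) (Some i, j, false))
    (bc (None, i, false) (None, j, false) (Some i, j, true)))
    (@continuous_const _ (complex.Im (A i j))).
  exact: (continuous_add (continuous_mul rec rec) (continuous_mul imc imc)).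
have cE p i j : commutator (point_diag p) (point_mx p) i j =
    (re p i j + complex.Re (A i j)) +i* (im p i j + complex.Im (A i j)).
  rewrite commutator_diag ?diag_mx_is_diag// !mxE !eqxx !mulr1n /re /im !subrK.
  by [].
have -> : [set p : point | A = commutator (point_diag p) (point_mx p)] =
    g @^-1` [set x | x = 0].
  apply/seteqP; split => p /=.
    move=> AE; rewrite /g big1// => i _; rewrite big1// => j _.
    move/matrixP/(_ i j): AE; rewrite cE; move: (re p i j) (im p i j) => u v.
    case: (A i j) => a b /= [/esym/eqP + /esym/eqP].
    by rewrite -subr_eq0 addrK -[in X in _ -> X -> _]subr_eq0 addrK => /eqP-> /eqP->;
      rewrite expr0n addr0.
  move=> gp0; apply/matrixP => i j; rewrite cE.
  have t0 i' j' : 0 <= re p i' j' ^+ 2 + im p i' j' ^+ 2 by rewrite addr_ge0 ?sqr_ge0.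
  have s0 i' : 0 <= \sum_j' (re p i' j' ^+ 2 + im p i' j' ^+ 2) by apply: sumr_ge0.
  have /psumr_eq0P/(_ i isT) := gp0 => /(_ (fun i' _ => s0 i')).
  move=> /psumr_eq0P/(_ j isT) => /(_ (fun j' _ => t0 i j')) /eqP.
  rewrite paddr_eq0 ?sqr_ge0// !sqrf_eq0 => /andP[/eqP-> /eqP->].
  by rewrite !add0r; case: (A i j).
by apply: closed_comp => // p _; exact: gc.
Qed.

(** A factor [D] that is no larger than a given one [D0] has entries bounded by
    [opnorm D0], so the pairs [(B, D)] that matter form a compact set. *)
Lemma exists_minimal_diagonal_commutator A : (forall i, A i i = 0) ->
  exists x, is_minimum (@opnorm R m @` diagonal_commutator_factors A) x.
Proof.
move=> A0; have [D0 D0A] := diagonal_commutator_factors_neq0 A0.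
pose M := opnorm D0.
pose bound (q : coord) : R := if q.1.1 is Some _ then M else 1.
pose K := [set p : point | forall q, `[- bound q, bound q] (p q)] `&`
  [set p : point | A = commutator (point_diag p) (point_mx p)].
pose pt B D : point := fun q => let: (o, j, r) := q in
  let z := if o is Some i then D i j else B j j in
  if r then complex.Re z else complex.Im z.
have ptB B D : is_diag_mx B -> point_diag (pt B D) = B.
  move=> /is_diag_mxP hB; apply/matrixP => i j; rewrite !mxE.
  have [<-|ij] := eqVneq i j; last by rewrite mulr0n hB.
  by rewrite mulr1n /point_entry /=; case: (B i i).
have ptD B D : point_mx (pt B D) = D.
  by apply/matrixP => i j; rewrite mxE /point_entry /=; case: (D i j).
have re_le (z : C) : `|complex.Re z| <= normc z.
  rewrite -ler_sqr ?nnegrE ?normr_ge0 ?normc_ge0// real_normK ?num_real//.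
  by rewrite sqr_normcE lerDl sqr_ge0.
have im_le (z : C) : `|complex.Im z| <= normc z.
  rewrite -ler_sqr ?nnegrE ?normr_ge0 ?normc_ge0// real_normK ?num_real//.
  by rewrite sqr_normcE lerDr sqr_ge0.
have inK D : diagonal_commutator_factors A D -> opnorm D <= M ->
    exists2 p, K p & point_mx p = D.
  move=> [B [Bdiag Bsq AE]] DM; exists (pt B D); last exact: ptD.
  split; last by rewrite /= ptD ptB.
  move=> [[[i|] j] r] /=; rewrite in_itv /= -ler_norml /bound /=.
    apply: le_trans DM; apply: le_trans (normc_le_opnorm D i j).
    by case: r; [exact: re_le|exact: im_le].
  by have [h1 h2] := Bsq j; case: r.
have boxc : compact [set p : point | forall q, `[- bound q, bound q] (p q)].
  apply: (@tychonoff _ (fun _ : coord => R) (fun q => `[- bound q, bound q])) => q.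
  exact: segment_compact.
have Kcompact : compact K.
  apply: (subclosed_compact _ boxc); last by move=> p [].
  apply: closedI; last exact: closed_commutator_eq.
  apply: (compact_closed _ boxc); apply: hausdorff_product => q; exact: Rhausdorff.
have [p0 p0K p0D0] := inK D0 D0A (lexx _).
have [p pK pmin] := compact_EVT_min (ex_intro _ p0 p0K) Kcompact
  (continuous_subspaceT continuous_opnorm_point_mx).
have [pbox pA] : K p by rewrite inE in pK.
have bnd q : `|p q| <= bound q by have := pbox q; rewrite /= in_itv /= -ler_norml.
exists (opnorm (point_mx p)); split.
  exists (point_mx p) => //; exists (point_diag p); split.
  - exact: diag_mx_is_diag.
  - by move=> i; rewrite !mxE eqxx mulr1n; split; apply: (bnd (None, i, _)).
  - exact: pA.
move=> _ [D DA <-]; have [DM|MD] := leP (opnorm D) M.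
  by have [p' p'K <-] := inK D DA DM; apply: pmin; rewrite inE.
apply: le_trans (ltW MD); have := pmin p0; rewrite inE p0D0; exact.
Qed.
End Attained.

(** * Lower bound for the diagonal commutator cost *)

Section CommutatorCost.
Variables (R : realType) (k : nat).
Local Notation C := R[i].
Local Notation A := (Amx R k).
Local Notation N := ((2 ^ k)%:R : R).
Hypothesis k_gt0 : (0 < k)%N.

(** Off the diagonal [A = B D - D B] reads [A i j = (b_i - b_j) * D i j]. The
    left side has modulus [1 / sqrt (N - 1)], so the points [b_i] are distinct and
    the off-diagonal part of the squared Frobenius norm of [D] is their
    inverse-square energy divided by [N - 1]. *)
Lemma diagonal_commutator_energy (D : 'M[C]_(2 ^ k)) j : (2 ^ k = 4 ^ j)%N ->
  diagonal_commutator_factors A D ->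
  3 * j%:R * N / 32 <= opnorm D ^+ 2 * (N - 1).
Proof.
move=> nj [B [Bdiag Bsq AE]].
pose x i := complex.Re (B i i); pose y i := complex.Im (B i i).
have N1 := pow2_sub1_gt0 R k_gt0.
pose d a b := (x a - x b) ^+ 2 + (y a - y b) ^+ 2.
have dE a b : (a != b)%:R = d a b * normc (D a b) ^+ 2 * (N - 1).
  have -> : d a b * normc (D a b) ^+ 2 = normc (A a b) ^+ 2.
    rewrite AE commutator_diag// normcM exprMn [in RHS]sqr_normcE /d /x /y.
    by case: (B a a) (B b b) => [? ?] [? ?].
  by rewrite sqr_normc_Amx// divfK// gt_eqF.
have d0 a b : 0 <= d a b by rewrite addr_ge0 ?sqr_ge0.
have dist a b : a != b -> 0 < d a b.
  move=> ab; rewrite lt_def d0 andbT; apply/eqP => dab; have := dE a b.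
  by rewrite ab dab !mul0r => /eqP; rewrite oner_eq0.
have x1 a : `|x a| <= 1 by case: (Bsq a).
have y1 a : `|y a| <= 1 by case: (Bsq a).
have cardI : #|'I_(2 ^ k)| = (4 ^ j)%N by rewrite card_ord.
have en := inverse_square_energy x1 y1 cardI dist.
rewrite card_ord in en.
have fr : \sum_a \sum_b (d a b)^-1 <= N * opnorm D ^+ 2 * (N - 1).
  apply: le_trans (ler_wpM2r (ltW N1) (frobenius_le D)).
  rewrite mulr_suml; apply: ler_sum => a _; rewrite mulr_suml; apply: ler_sum => b _.
  have [->|ab] := eqVneq a b.
    by rewrite /d !subrr expr0n addr0 invr0 mulr_ge0 ?sqr_ge0// ltW.
  have := dE a b; rewrite ab -mulrA => e.
  by rewrite -[leLHS]mulr1 /= [1 in leLHS]e mulKf// gt_eqF// dist.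
have N0 : 0 < N by rewrite ltr0n expn_gt0.
rewrite -(ler_pM2l N0); apply: le_trans (_ : _ <= \sum_a \sum_b (d a b)^-1) _.
  by apply: le_trans en; rewrite expr2; lra.
by rewrite mulrA.
Qed.

Lemma lambda_Amx_ge j : (0 < j)%N -> (2 ^ k = 4 ^ j)%N ->
  Num.sqrt (((3 * j%:R - 1) * N + 1) / (32 * (N - 1))) <= lambda A.
Proof.
move=> j0 nj; have [x xmin] := exists_minimal_diagonal_commutator (@Amx_diag R k).
have N1 := pow2_sub1_gt0 R k_gt0.
rewrite /lambda (minimumE xmin); case: xmin => -[D DA <-] _.
rewrite -[leRHS]ger0_norm ?opnorm_ge0// -sqrtr_sqr ler_wsqrtr//.
rewrite ler_pdivrMr ?mulr_gt0//.
have := diagonal_commutator_energy nj DA; have := pow2_ge1 R k.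
move: N (opnorm D ^+ 2) j%:R => n t u; lra.
Qed.

(** After squaring and clearing denominators, this is [(j - 1) N + 2 j + 1 >= 0]. *)
Lemma quarter_sqrt_le_bound j : (0 < j)%N ->
  Num.sqrt j%:R / 4 <= Num.sqrt (((3 * j%:R - 1) * N + 1) / (32 * (N - 1))) :> R.
Proof.
move=> j0; have N1 := pow2_sub1_gt0 R k_gt0; have N0 : 1 <= N by exact: pow2_ge1.
have -> : Num.sqrt j%:R / 4 = Num.sqrt (j%:R / 16) :> R.
  rewrite sqrtrM ?ler0n// sqrtrV ?ler0n//; congr (_ / _).
  have -> : 16 = 4 ^+ 2 :> R by ring.
  by rewrite sqrtr_sqr ger0_norm.
rewrite ler_wsqrtr// ler_pdivlMr ?mulr_gt0//.
have j1 : 1 <= j%:R :> R by rewrite ler1n.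
have : 0 <= (j%:R - 1) * N by rewrite mulr_ge0 ?subr_ge0// (le_trans ler01).
by lra.
Qed.
End CommutatorCost.

Theorem theorem1p2 (R : realType) (k : nat) (hk : (0 < k)%N) :
  let n := (2 ^ k)%N in
  let A : 'M[R[i]]_n := Amx R k in
  [/\ [/\ forall i, A i i = 0, A \is hermsymmx & A \is unitarymx],
      (forall l : nat, (2 ^ l <= n)%N ->
         paving_number (2 ^ l) A
           = Num.sqrt ((n%:R / (2 ^ l)%:R - 1) / (n%:R - 1)))
      /\ (forall eps : R, 0 < eps -> eps < 1 ->
            exists2 P : {set {set 'I_n}},
              is_paving eps A P & #|P|%:R < 2 * eps ^- 2),
      is_minimum (normal_commutator_costs A) (1 / 2) &
      forall j : nat, (0 < j)%N -> n = (4 ^ j)%N ->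
        Num.sqrt (((3 * j%:R - 1) * n%:R + 1) / (32 * (n%:R - 1))) <= lambda A
        /\ Num.sqrt j%:R / 4
             <= Num.sqrt (((3 * j%:R - 1) * n%:R + 1) / (32 * (n%:R - 1))) :> R].
Proof.
move=> n A; split.
- by split; [exact: Amx_diag|exact: Amx_herm|exact: Amx_unitary].
- split; last by move=> eps; exact: exists_paving_Amx.
  by move=> l; rewrite leq_exp2l// => lk; exact: paving_number_Amx.
- exact: normal_commutator_costs_Amx.
- move=> j j0 nj; split; last exact: quarter_sqrt_le_bound.
  exact: lambda_Amx_ge.
Qed.
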